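(* Let $c,d\ge 1$ and $n\ge 1$ be integers and let $\mathcal T_1,\ldots,\mathcal T_n\in \mathrm U(c,d)$. Then $$\int_0^1 N_{d}\big(\mathcal U^{(c,d)}_\theta \mathcal T_1\, \mathcal U^{(c,d)}_\theta \mathcal T_2\cdots \mathcal U^{(c,d)}_\theta \mathcal T_n\big)\,d\theta\,=\,\sum_{j=1}^n N_{d}(\mathcal T_j)$$ and $$\int_0^1 \ln\Big(\rho\big(\Lambda^{d}(\mathcal U^{(c,d)}_\theta \mathcal T_1\, \mathcal U^{(c,d)}_\theta \mathcal T_2\cdots \mathcal U^{(c,d)}_\theta \mathcal T_n)\big)\Big)\,d\theta\,=\,\sum_{j=1}^n N_{d}(\mathcal T_j),$$ where $\rho(\cdot)$ denotes the spectral radius and $\Lambda^d$ the $d$-th exterior power.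
   Context: $\mathrm U(c,d)=\{\mathcal T\in \mathrm{Mat}(c+d,\mathbb C): \mathcal T^*\mathcal G_{c,d}\mathcal T=\mathcal G_{c,d}\}$ with $\mathcal G_{c,d}=\begin{pmatrix}\mathbf 1_c&0\\0&-\mathbf 1_d\end{pmatrix}$, where $\mathbf 1_k$ is the $k\times k$ identity matrix. For $\theta\in[0,1]$, $\mathcal U^{(c,d)}_\theta=\begin{pmatrix}e^{2\pi i\theta}\mathbf 1_c&0\\0&\mathbf 1_d\end{pmatrix}\in \mathrm U(c,d)$. For $\mathcal T\in \mathrm{GL}(m,\mathbb C)$ with singular values $\sigma_1(\mathcal T)\ge\dots\ge\sigma_m(\mathcal T)$ and $1\le r\le m$, $N_r(\mathcal T)=\sum_{i=1}^r\ln\left(\frac{\sigma_i(\mathcal T)+\sigma_i(\mathcal T)^{-1}}{2}\right)$. *)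

(* Defs.v *)
From mathcomp Require Import all_boot all_order all_fingroup all_algebra.
From mathcomp Require Import complex.
From mathcomp Require Import all_classical all_reals all_analysis.

Set Implicit Arguments.
Unset Strict Implicit.
Unset Printing Implicit Defensive.

Import Order.TTheory GRing.Theory Num.Theory.

Local Open Scope ring_scope.
Local Open Scope complex_scope.
Local Open Scope sesquilinear_scope.
Local Open Scope classical_set_scope.

Definition Gmx (R : realType) (c d : nat) : 'M[R[i]]_(c + d) :=
  block_mx 1%:M 0 0 (- 1%:M).

Definition Ugrp (R : realType) (c d : nat) : set 'M[R[i]]_(c + d) :=
  [set T | T ^t* *m Gmx R c d *m T = Gmx R c d].
Arguments Ugrp : clear implicits.

Definition cis (R : realType) (x : R) : R[i] := cos x +i* sin x.

Definition Umx (R : realType) (c d : nat) (theta : R) : 'M[R[i]]_(c + d) :=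
  block_mx (cis (2 * pi * theta))%:M 0 0 1%:M.

(* The singular values in nonincreasing order, repeated with multiplicity: the
   square roots of the eigenvalues of T^* T, which are real and nonnegative,
   so that complex.Re loses nothing.  Indices start at 0. *)
Definition singular_values (R : realType) (m : nat) (T : 'M[R[i]]_m) : seq R :=
  sort (fun x y : R => y <= x)
    [seq Num.sqrt (complex.Re (spectral_diag (T ^t* *m T) 0 i)) | i : 'I_m].

Definition Nfun (R : realType) (r m : nat) (T : 'M[R[i]]_m) : R :=
  \sum_(i < r) ln ((nth 0 (singular_values T) i +
                    (nth 0 (singular_values T) i)^-1) / 2).

(* The strictly increasing r-tuples s = (s_1 < ... < s_r) in 'I_m index the
   basis e_(s_1) /\ ... /\ e_(s_r) of the r-th exterior power of C^m. *)
Definition wedge_index (r m : nat) : {set r.-tuple 'I_m} :=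
  [set s : r.-tuple 'I_m | sorted ltn (map val s)].

(* The coordinates of v_1 /\ ... /\ v_r, where v_1, ..., v_r are the columns of V. *)
Definition wedge (R : realType) (r m : nat) (V : 'M[R[i]]_(m, r)) :
    'cV[R[i]]_#|wedge_index r m| :=
  \col_s \det (rowsub (tnth (enum_val s)) V).

(* The matrix, in that basis, of the operator
     v_1 /\ ... /\ v_r |-> (T v_1) /\ ... /\ (T v_r)
   induced by T: the coefficient of e_s in T e_(t_1) /\ ... /\ T e_(t_r) is the
   minor of T with rows s and columns t. *)
Definition ext_power (R : realType) (r m : nat) (T : 'M[R[i]]_m) :
    'M[R[i]]_#|wedge_index r m| :=
  \matrix_(s, t) \det (mxsub (tnth (enum_val s)) (tnth (enum_val t)) T).

Lemma det_mul_ffun (K : comPzRingType) (r m : nat) (A : 'M[K]_(r, m)) (B : 'M[K]_(m, r)) :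
  \det (A *m B) =
  \sum_(f : {ffun 'I_r -> 'I_m}) (\prod_i A i (f i)) * \det (rowsub f B).
Proof.
rewrite {1}/determinant.
under eq_bigr => s _.
  under eq_bigr => i _ do rewrite mxE.
  rewrite bigA_distr_bigA /= mulr_sumr; over.
rewrite exchange_big /=; apply: eq_bigr => f _.
rewrite /determinant mulr_sumr; apply: eq_bigr => s _.
rewrite big_split /= mulrCA; congr (_ * (_ * _)).
by apply: eq_bigr => i _; rewrite !mxE.
Qed.

Lemma Cauchy_Binet (K : comPzRingType) (r m : nat) (A : 'M[K]_(r, m)) (B : 'M[K]_(m, r)) :
  \det (A *m B) =
  \sum_(s in wedge_index r m) \det (colsub (tnth s) A) * \det (rowsub (tnth s) B).
Proof.
rewrite det_mul_ffun (bigID (fun f : {ffun 'I_r -> 'I_m} => injectiveb f)) /=.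
rewrite [X in _ + X]big1 ?addr0; last first.
  move=> f /injectivePn[i [j ij fij]].
  by rewrite (determinant_alternate ij) ?mulr0// => k; rewrite !mxE fij.
pose le_ (x y : 'I_m) := (x <= y)%N.
have leT : total le_ by move=> x y; exact: leq_total.
have leTr : transitive le_ by move=> x y z; exact: leq_trans.
have leA : antisymmetric le_ by move=> x y /anti_leq /val_inj.
have srt (s : r.-tuple 'I_m) : s \in wedge_index r m -> sorted le_ s /\ uniq s.
  rewrite inE ltn_sorted_uniq_leq => /andP[us ss]; split.
    by move: ss; rewrite sorted_map.
  by rewrite (map_inj_uniq val_inj) in us.
pose phi (f : {ffun 'I_r -> 'I_m}) : r.-tuple 'I_m :=
  sort_tuple le_ [tuple f i | i < r].
have phiP (f : {ffun 'I_r -> 'I_m}) : injectiveb f -> phi f \in wedge_index r m.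
  move=> /injectiveP f_inj; rewrite inE ltn_sorted_uniq_leq.
  rewrite (map_inj_uniq val_inj) sort_uniq map_inj_uniq ?val_enum_uniq ?enum_uniq //=.
  by rewrite sorted_map; exact: sort_sorted.
rewrite (partition_big phi (mem (wedge_index r m))) //=.
apply: eq_bigr => s sW; have [ss us] := srt s sW.
have tI : injective (tnth s) by apply/tuple_uniqP.
pose h (p : 'S_r) : {ffun 'I_r -> 'I_m} := [ffun i => tnth s (p i)].
have h_inj : injective h.
  by move=> p q /ffunP E; apply/permP => i; have := E i; rewrite !ffunE => /tI.
pose h' (f : {ffun 'I_r -> 'I_m}) : 'S_r := odflt 1%g [pick p | f == h p].
rewrite (reindex_onto h h'); last first.
  move=> f /andP[_ /eqP phif]; rewrite /h'; case: pickP => [p /eqP <- //|/=].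
  have /tuple_permP[p Ep] : perm_eq [tuple f i | i < r] s.
    by rewrite -phif perm_sym perm_sort.
  move/(_ p)/eqP; case; apply/ffunP => i.
  have := congr1 (fun t : seq _ => nth (f i) t i) Ep.
  rewrite -!tnth_nth !tnth_mktuple ffunE //.
rewrite {1}/determinant mulr_suml; apply: eq_big => [p|p _].
  rewrite /h'; case: pickP => [q /eqP/h_inj<-|/(_ p)/eqP//].
  rewrite eqxx andbT; apply: esym.
  suff: injectiveb (h p) && (phi (h p) == s) by [].
  apply/andP; split.
    by apply/injectiveP => i j; rewrite !ffunE => /tI/perm_inj.
  apply/eqP/val_inj => /=; apply: (sorted_eq leTr leA) => //.
    exact: sort_sorted.
  rewrite perm_sort; apply/tuple_permP; exists p.
  have E : [tuple h p i | i < r] = [tuple tnth s (p i) | i < r].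
    by apply: eq_from_tnth => i; rewrite !tnth_mktuple ffunE.
  by rewrite -E.
rewrite -[X in _ * X = _]/(\det (rowsub (h p) B)).
have -> : rowsub (h p) B = row_perm p (rowsub (tnth s) B).
  by apply/matrixP => i j; rewrite !mxE ffunE.
rewrite row_permE det_mulmx det_perm mulrA [_ * (-1) ^+ _]mulrC.
by congr (_ * _ * _); apply: eq_bigr => i _; rewrite !mxE ffunE.
Qed.

Lemma ext_power_wedge (R : realType) (r m : nat) (T : 'M[R[i]]_m)
    (V : 'M[R[i]]_(m, r)) :
  ext_power r T *m wedge V = wedge (T *m V).
Proof.
apply/colP => s; rewrite !mxE -mul_rowsub_mx Cauchy_Binet [RHS]big_enum_val /=.
by apply: eq_bigr => t _; rewrite !mxE -mxsub_comp.
Qed.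

Definition spectral_radius (R : realType) (m : nat) (A : 'M[R[i]]_m) : R :=
  sup [set ComplexField.Normc.normc a | a in [set a : R[i] | eigenvalue A a]].

(* Main.v *)
(* Write [D T] for the lower right block of [T].  For [T] in U(c,d),
   [T G (1 + T^* T) = T G + G T] is block diagonal, so that the product over all
   singular values of [(s + 1/s)/2] is [|det D T|^2].  Singular values come in
   pairs (s, 1/s) and at most 2 min(c,d) of them differ from 1; hence
   [N_d T = ln |det D T|].
   Replacing [e^(2 pi i theta)] by a complex number [z] turns the block [D] of the
   product into a polynomial matrix.  For [|z| <= 1] the product contracts the
   indefinite form [G], so that block stays invertible, and Jensen's formula gives
   the mean as [ln |det D|] at [z = 0], where the product degenerates to
   [diag(0, 1) T_1 ... diag(0, 1) T_n].
   For the spectral radius, [det D] of the k-th power [M^k] of the product is a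
   diagonal entry of the k-th power of the exterior power of [M]; it dominates all
   other entries, so [N_d (M^k) / k] tends to the logarithm of the spectral radius.
   The first formula applied to [M^k] and dominated convergence conclude. *)
Require Import Defs.
From mathcomp Require Import all_boot all_order all_algebra.
From mathcomp Require Import complex.
From mathcomp Require Import all_classical all_reals all_analysis.
From mathcomp Require Import ring lra zify.

Set Implicit Arguments.
Unset Strict Implicit.
Unset Printing Implicit Defensive.

Import Order.TTheory GRing.Theory Num.Theory.
Import numFieldNormedType.Exports.

Local Open Scope ring_scope.
Local Open Scope complex_scope.
Local Open Scope sesquilinear_scope.
Local Open Scope classical_set_scope.

(** * Jensen's formula *)

Local Notation normc := ComplexField.Normc.normc.

Section mean_unit_interval.
Variable R : realType.
Implicit Types f g : R -> R.
Local Notation mu := (@lebesgue_measure R).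

Lemma continuous_integrable_itv f (a b : R) :
  continuous f -> mu.-integrable `[a, b] (EFin \o f).
Proof.
move=> cf; apply: continuous_compact_integrable; first exact: segment_compact.
exact: continuous_subspaceT.
Qed.

(** Passes from extended-real integrals to real-valued ones, in which the algebra of the means is
    carried out. *)
Lemma integral_continuous f (a b : R) : continuous f ->
  (\int[mu]_(x in `[a, b]) (f x)%:E = (\int[mu]_(x in `[a, b]) f x)%:E)%E.
Proof.
move=> cf; rewrite /Rintegral fineK //; apply: integrable_fin_num => //.
exact: continuous_integrable_itv.
Qed.

Lemma Rintegral_affine f (a b s t : R) : continuous f -> 0 < s -> a <= b ->
  (\int[mu]_(x in `[(s * a + t)%R, (s * b + t)%R]) f x =
   s * \int[mu]_(x in `[a, b]) f (s * x + t))%R.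
Proof.
move=> cf s0 ab.
have dF (x : R) : is_derive x (1 : R) (fun y : R => s * y + t) s.
  have -> : (fun y : R => s * y + t) = s *: (@id R) + cst t by [].
  by apply: is_derive_eq; rewrite addr0 /GRing.scale /= mulr1.
have F'E : (fun y : R => s * y + t)^`() = cst s.
  by apply/funext => x; rewrite derive1E derive_val.
have cF : continuous (fun y : R => s * y + t).
  move=> x; apply: differentiable_continuous; apply/derivable1_diffP.
  by case: (dF x).
pose F (y : R) : R := s * y + t.
have := @integration_by_substitution_increasing R F f a b ab.
rewrite F'E -/(F a) -/(F b) /Rintegral => ->; first last.
- exact: continuous_subspaceT.
- split.
  + by move=> x _; case: (dF x).
  + exact/cvg_at_right_filter/cF.
  + exact/cvg_at_left_filter/cF.
- exact: is_cvg_cst.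
- exact: is_cvg_cst.
- by move=> x _; exact: cvg_cst.
- by move=> x y _ _ xy; rewrite ltrD2r ltr_pM2l.
have -> : (fun x => (((f \o F) * cst s) x)%:E) =
          (fun x => (s%:E * (f (s * x + t))%:E)%E).
  by apply/funext => x; rewrite -EFinM mulrC.
rewrite integralZl //; last first.
  apply: continuous_integrable_itv => x.
  by apply: continuous_comp; [exact: cF|exact: cf].
rewrite fineM //; apply: integrable_fin_num => //.
apply: (@continuous_integrable_itv (fun x => f (s * x + t))) => x.
by apply: continuous_comp; [exact: cF|exact: cf].
Qed.

(** Splitting at [1/2] and rescaling each half turns a mean over the circle into a mean over pairs
    of opposite points. *)
Lemma Rintegral_halves f : continuous f ->
  (\int[mu]_(x in `[0%R, 1%R]) f x =
   2^-1 * \int[mu]_(x in `[0%R, 1%R]) (f (x / 2) + f ((x + 1) / 2)%R))%R.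
Proof.
move=> cf.
have caff s t : continuous (fun x : R => f (s * x + t)).
  move=> x; apply: (@continuous_comp _ _ _ (fun x : R => s * x + t)); last exact: cf.
  by apply: cvgD; [apply: cvgM; [exact: cvg_cst|exact: cvg_id]|exact: cvg_cst].
have /(@Rintegral_itvB _ _ _ _ 2^-1) := continuous_integrable_itv 0 1 cf.
rewrite !bnd_simp invr_ge0 ler0n invf_le1 // ler1n => /(_ isT isT)/eqP.
rewrite subr_eq => /eqP ->.
rewrite Rintegral_itv_obnd_cbnd; last first.
  apply: integrableS (continuous_integrable_itv 2^-1 1 cf) => //.
  by apply: subset_itvr; rewrite bnd_simp.
have -> : (fun x => f (x / 2) + f ((x + 1) / 2)) =
          (fun x => f (2^-1 * x + 0) + f (2^-1 * x + 2^-1)).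
  by apply/funext => x; rewrite addr0 mulrDl mul1r (mulrC x).
rewrite RintegralD //; try exact: continuous_integrable_itv.
rewrite mulrDr -!Rintegral_affine ?invr_gt0 ?ltr0n ?ler01 // addrC.
have E : 2^-1 + 2^-1 = 1 :> R by lra.
by rewrite !mulr0 mulr1 add0r !addr0 E add0r.
Qed.

Lemma Rintegral_cst01 (k : R) : (\int[mu]_(x in `[0%R, 1%R]) k = k)%R.
Proof.
have -> : (\int[mu]_(x in `[0%R, 1%R]) k = k * fine (mu `[0%R, 1%R]))%R.
  by rewrite Rintegral_cst.
have -> : mu `[0%R, 1%R] = 1%:E; last by rewrite mulr1.
by rewrite lebesgue_measure_itv /= lte_fin ltr01 oppr0 adde0.
Qed.

Lemma cisD (x y : R) : cis (x + y) = cis x * cis y.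
Proof.
rewrite /cis cosD sinD; apply/eqP; rewrite eq_complex /=.
by rewrite eqxx (addrC (sin x * _)) eqxx.
Qed.

Lemma normc_cis (x : R) : normc (cis x) = 1.
Proof. by rewrite /= cos2Dsin2 sqrtr1. Qed.

(** The contribution of a root [r] to the logarithm of a polynomial's modulus on the unit circle. *)
Definition logdist (r : R[i]) (x : R) : R := ln (normc (cis (2 * pi * x) - r)).

Lemma normc_ge0 (z : R[i]) : 0 <= normc z.
Proof. by case: z => a b /=; exact: sqrtr_ge0. Qed.

Lemma ler_normcB (z w : R[i]) : normc w - normc z <= normc (z - w).
Proof.
rewrite lerBlDr -[X in normc X <= _](subKr z) addrC.
by apply: le_trans (le_normcD _ _) _; rewrite normcN.
Qed.

Lemma normc_sub_gt0 (r z : R[i]) : normc z = 1 -> 1 < normc r ->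
  0 < normc (z - r).
Proof.
by move=> z1 r1; apply: lt_le_trans (ler_normcB _ _); rewrite z1 subr_gt0.
Qed.

Lemma continuous_logdist r : 1 < normc r -> continuous (logdist r).
Proof.
move=> r1 x; rewrite /logdist.
apply: (@continuous_comp R R R (fun y => normc (cis (2 * pi * y) - r)) (@ln R));
  last first.
  by apply: continuous_ln; apply: normc_sub_gt0 => //; exact: normc_cis.
case: r r1 => a b _ /=.
have c2 : continuous (fun y : R => 2 * pi * y).
  by move=> y; apply: cvgM; [exact: cvg_cst|exact: cvg_id].
apply: continuous_comp; last exact: sqrt_continuous.
apply: cvgD.
  apply: cvgM; (apply: cvgB; last exact: cvg_cst);
    (apply: continuous_comp; [exact: c2|exact: continuous_cos]).
apply: cvgM; (apply: cvgB; last exact: cvg_cst);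
    (apply: continuous_comp; [exact: c2|exact: continuous_sin]).
Qed.

Lemma logdist_halves r x : 1 < normc r ->
  logdist r (x / 2) + logdist r ((x + 1) / 2) = logdist (r ^+ 2) x.
Proof.
move=> r1; rewrite /logdist -lnM ?posrE ?normc_sub_gt0 ?normc_cis //.
rewrite -ComplexField.Normc.normcM.
have -> : 2 * pi * ((x + 1) / 2) = pi * x + pi :> R by field.
have -> : 2 * pi * (x / 2) = pi * x :> R by field.
have -> : 2 * pi * x = pi * x + pi * x :> R by ring.
have -> : cis (pi * x + pi) = - cis (pi * x).
  by rewrite /cis cosDpi sinDpi.
rewrite cisD; set z := cis _.
have -> : (z - r) * (- z - r) = - (z * z - r ^+ 2) by ring.
by rewrite normcN.
Qed.

(** On the circle, [|z - r| / |r|] lies between [1 - 1/r0] and 2. The bound must be uniform in [r],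
    because [r] gets squared repeatedly later on. *)
Lemma logdist_bound (r0 : R) : 1 < r0 -> exists C, forall r x, r0 <= normc r ->
  `|logdist r x - ln (normc r)| <= C.
Proof.
(* The sum of [ln 2] and [- ln (1 - r0^-1)], both nonnegative, bounds the logarithm of the quotient
   on either side. *)
move=> r01; exists (ln 2 - ln (1 - r0^-1)) => r x r0r.
have r1 := lt_le_trans r01 r0r; have r_gt0 := lt_trans ltr01 r1.
have r0_gt0 := lt_trans ltr01 r01.
rewrite /logdist -ln_div ?posrE // ?normc_sub_gt0 ?normc_cis //.
set z := cis _; set q := _ / _.
have q1 : 1 - r0^-1 <= q.
  rewrite ler_pdivlMr // (le_trans _ (ler_normcB _ _)) // normc_cis.
  by rewrite mulrBl mul1r lerD2l lerN2 ler_pdivlMl // mulr1.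
have q2 : q <= 2.
  rewrite ler_pdivrMr // (le_trans (le_normcD _ _)) // normcN normc_cis.
  by rewrite mulr_natl mulr2n lerD2r ltW.
have p0 : 0 < 1 - r0^-1 by rewrite subr_gt0 invf_lt1.
have q0 : 0 < q by exact: lt_le_trans q1.
have l2 : 0 <= ln 2 :> R by rewrite ln_ge0 // ler1n.
have l0 : ln (1 - r0^-1) <= 0 by rewrite ln_le0 // gerBl invr_ge0 ltW.
have lq1 : ln (1 - r0^-1) <= ln q by rewrite ler_ln ?posrE.
have lq2 : ln q <= ln 2 by rewrite ler_ln ?posrE ?ltr0n.
by rewrite ler_norml; apply/andP; split; lra.
Qed.

(* Since (z - r)(-z - r) = r^2 - z^2, the mean of [logdist r] is half the mean
   of [logdist (r^2)]; as the deviation from [ln (normc r)] is bounded, iterating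
   kills it. *)
Lemma Rintegral_logdist r : 1 < normc r ->
  (\int[mu]_(x in `[0%R, 1%R]) logdist r x = ln (normc r))%R.
Proof.
move=> r1; have [C CP] := logdist_bound r1.
pose J (s : R[i]) : R := (\int[mu]_(x in `[0%R, 1%R]) logdist s x)%R - ln (normc s).
have JC s : normc r <= normc s -> `|J s| <= C.
  move=> rs; have s1 := lt_le_trans r1 rs; have cs := continuous_logdist s1.
  have : forall x, - C + ln (normc s) <= logdist s x <= C + ln (normc s).
    by move=> x; have := CP s x rs; rewrite ler_norml lerBlDr lerBrDr.
  move=> bd; rewrite ler_norml /J lerBlDr lerBrDr; apply/andP; split.
    rewrite -[X in X <= _]Rintegral_cst01; apply: le_Rintegral => //.
    - exact/continuous_integrable_itv/cst_continuous.
    - exact: continuous_integrable_itv.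
    - by move=> x _; case/andP: (bd x).
  rewrite -[X in _ <= X]Rintegral_cst01; apply: le_Rintegral => //.
  - exact: continuous_integrable_itv.
  - exact/continuous_integrable_itv/cst_continuous.
  - by move=> x _; case/andP: (bd x).
have JJ s : 1 < normc s -> J s = 2^-1 * J (s ^+ 2).
  move=> s1; rewrite /J Rintegral_halves; last exact: continuous_logdist.
  under eq_Rintegral do rewrite logdist_halves //.
  rewrite expr2 ComplexField.Normc.normcM lnM ?posrE ?(lt_trans ltr01 s1) //.
  by rewrite mulrBr; congr (_ - _); lra.
have JCk k : forall s, normc r <= normc s -> `|J s| <= C / 2 ^+ k.
  elim: k => [|k IH] s rs; first by rewrite expr0 divr1; exact: JC.
  have s1 := lt_le_trans r1 rs.
  rewrite JJ // normrM ger0_norm ?invr_ge0 ?ler0n // (exprS 2 k) invfM mulrCA.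
  rewrite ler_pM2l ?invr_gt0 ?ltr0n //; apply: IH.
  rewrite expr2 ComplexField.Normc.normcM (le_trans rs) // ler_peMr //.
    exact: normc_ge0.
  exact: ltW.
apply/eqP; rewrite -subr_eq0 -normr_le0.
have cvg0 : (fun k => C * 2^-1 ^+ k) @ \oo --> (C * 0 : R).
  apply: cvgM; first exact: cvg_cst.
  by apply: cvg_expr; rewrite ger0_norm ?invf_lt1 ?invr_ge0 ?ler0n ?ltr0n // ltr1n.
rewrite mulr0 in cvg0.
have lim0 := cvg_lim (@Rhausdorff R) cvg0.
rewrite -[leRHS]lim0; apply: limr_ge; first exact: cvgP cvg0.
by apply: nearW => k; rewrite exprVn; exact: JCk.
Qed.

Lemma normc_gt0 (z : R[i]) : (0 < normc z) = (z != 0).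
Proof.
rewrite lt_neqAle normc_ge0 andbT eq_sym; congr negb.
apply/eqP/eqP => [/ComplexField.Normc.eq0_normc //|->].
exact: ComplexField.Normc.normc0.
Qed.

(** Jensen's formula without zeros in the closed disc: [p] splits into linear factors, and each
    root, being outside the disc, contributes [ln |r|], its value at the origin. Continuity is
    carried through the induction to make the summands integrable. *)
Lemma Rintegral_log_poly (p : {poly R[i]}) :
    (forall z, normc z <= 1 -> p.[z] != 0) ->
  continuous (fun x : R => ln (normc p.[cis (2 * pi * x)])) /\
  (\int[mu]_(x in `[0%R, 1%R]) ln (normc p.[cis (2 * pi * x)]) = ln (normc p.[0]))%R.
Proof.
have [rs ->] := closed_field_poly_normal p; set c := lead_coef p.
elim: rs => [|r rs IH] nz.
  move: nz; set q := c *: _ => _.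
  have E z : q.[z] = c by rewrite /q big_nil !hornerE.
  under eq_fun do rewrite E.
  by rewrite E Rintegral_cst01; split=> //; exact: cst_continuous.
set q := c *: _ in IH.
move: nz; set q1 := c *: _ => nz.
have E z : q1.[z] = (z - r) * q.[z].
  by rewrite /q1 big_cons /q scalerAr hornerM !hornerE.
have qn0 z : normc z <= 1 -> q.[z] != 0.
  by move=> /nz; rewrite E mulf_eq0 negb_or => /andP[].
have r1 : 1 < normc r.
  by rewrite ltNge; apply/negP => /nz; rewrite E subrr mul0r eqxx.
have {IH}[cq Iq] := IH qn0.
have fE : (fun x : R => ln (normc q1.[cis (2 * pi * x)])) =
          (fun x => logdist r x + ln (normc q.[cis (2 * pi * x)])).
  apply/funext => x; rewrite E ComplexField.Normc.normcM lnM //.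
    by rewrite posrE normc_sub_gt0 // normc_cis.
  by rewrite posrE normc_gt0 qn0 // normc_cis.
rewrite fE; split.
  move=> x; apply: (@cvgD _ _ _ _ _ (logdist r)); last exact: cq.
  exact: continuous_logdist.
rewrite RintegralD //; first last.
- exact: continuous_integrable_itv.
- exact/continuous_integrable_itv/continuous_logdist.
rewrite Rintegral_logdist // Iq E sub0r ComplexField.Normc.normcM normcN lnM //.
  by rewrite posrE (lt_trans ltr01).
by rewrite posrE normc_gt0 qn0 // ComplexField.Normc.normc0.
Qed.

End mean_unit_interval.

(** * Sequences closed under inversion, ranks and characteristic polynomials *)

Lemma char_poly_similar (K : fieldType) (m : nat) (P A B : 'M[K]_m) :
  P \in unitmx -> P *m A = B *m P -> char_poly A = char_poly B.
Proof.
move=> Pu PA; rewrite /char_poly.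
have dP : \det (map_mx polyC P) != 0.
  by rewrite det_map_mx polyC_eq0 -unitfE -unitmxE.
apply: (mulfI dP); rewrite [RHS]mulrC -!det_mulmx; congr (\det _).
by rewrite /char_poly_mx mulmxBr mulmxBl -!map_mxM PA mul_mx_scalar mul_scalar_mx.
Qed.

(** The rows and columns indexed by the support cut out an invertible diagonal submatrix. *)
Lemma card_support_le_rank_diag (K : fieldType) (m : nat) (v : 'rV[K]_m) :
  (#|[pred i : 'I_m | v 0%R i != 0%R]| <= \rank (diag_mx v))%N.
Proof.
set A := [pred i | _].
pose S := rowsub (fun i : 'I_#|A| => enum_val i) (1%:M : 'M[K]_m).
have E : S *m diag_mx v *m S^T = diag_mx (\row_i v 0 (enum_val i)).
  apply/matrixP => i j; rewrite /S mul_rowsub_mx mul1mx !mxE.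
  rewrite (bigD1 (enum_val j)) //= big1 ?addr0.
    by rewrite !mxE eqxx mulr1 (inj_eq enum_val_inj).
  by move=> k kj; rewrite !mxE (eq_sym (enum_val j)) (negbTE kj) mulr0.
have : \rank (S *m diag_mx v *m S^T) = #|A|.
  rewrite E mxrank_unit // unitmxE det_diag unitfE; apply/prodf_neq0 => i _.
  by rewrite mxE; have := enum_valP i; rewrite inE.
move=> <-; apply: leq_trans (mxrankM_maxl _ _) (mxrankM_maxr _ _).
Qed.

(** In a nonincreasing sequence, the two counts force the first [d] entries to contain all those
    above 1 and otherwise only ones, where [f] vanishes. *)
Lemma sum_nth_gt1 (R : realType) (f : R -> R) (c d : nat) (s : seq R) :
  f 1 = 0 -> sorted (fun x y => y <= x) s -> size s = (c + d)%N ->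
  (count (fun x : R => (1 < x)%R) s <= d)%N ->
  (count (fun x : R => (x < 1)%R) s <= c)%N ->
  \sum_(i < d) f (nth 0 s i) = \sum_(x <- s | 1 < x) f x.
Proof.
move=> f1 ss szs c1 c2.
have leT : transitive (fun x y : R => y <= x) by move=> x y z /[swap]; exact: le_trans.
have mono := sorted_leq_nth leT (@lexx _ R) 0 ss.
(* Otherwise all entries from position [i] on are below 1, and these are more than [c]. *)
have take_ge1 i : (i < d)%N -> 1 <= nth 0 s i.
  move=> id; rewrite leNgt; apply/negP => lt1.
  suff : (c < count (fun x => (x < 1)%R) s)%N by rewrite ltnNge c2.
  rewrite -(cat_take_drop i s) count_cat.
  have : all (fun x => (x < 1)%R) (drop i s).
    apply/(all_nthP 0) => j; rewrite size_drop ltn_subRL => ij.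
    rewrite nth_drop; apply: le_lt_trans lt1; apply: mono; rewrite ?inE ?leq_addr //.
    by apply: leq_ltn_trans ij; rewrite leq_addr.
  rewrite all_count => /eqP ->; rewrite size_drop szs ltn_addl // ltn_subRL addnC; lia.
have drop_le1 i : (d <= i)%N -> (i < c + d)%N -> nth 0 s i <= 1.
  move=> di icd; rewrite leNgt; apply/negP => lt1.
  suff : (d < count (fun x => (1 < x)%R) s)%N by rewrite ltnNge c1.
  rewrite -(cat_take_drop i.+1 s) count_cat.
  have : all (fun x => (1 < x)%R) (take i.+1 s).
    apply/(all_nthP 0) => j; rewrite size_takel ?szs // => ij.
    rewrite nth_take //; apply: lt_le_trans lt1 _; apply: mono; rewrite ?inE ?szs //.
    exact: leq_trans ij icd.
  by rewrite all_count => /eqP ->; rewrite size_takel ?szs // ltn_addr.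
rewrite (big_nth 0) szs addnC (big_cat_nat (n := d)) ?leq_addr //=.
rewrite [X in _ = _ + X]big_nat_cond [X in _ = _ + X]big1 ?addr0.
  rewrite big_mkord [RHS]big_mkcond; apply: eq_bigr => i _; case: ltP => // le1.
  have -> : nth 0 s i = 1 by apply/eqP; rewrite eq_le le1 take_ge1.
  by [].
move=> i /andP[/andP[di icd] lt1].
by have := drop_le1 i di; rewrite addnC icd => /(_ isT); rewrite leNgt lt1.
Qed.

(** Inversion exchanges the entries above 1 with those below 1 and preserves [f], while the entries
    equal to 1 contribute nothing. *)
Lemma sum_gt1_half (R : realType) (f : R -> R) (s : seq R) :
  f 1 = 0 -> {in s, forall x, 0 < x /\ f x^-1 = f x} ->
  perm_eq s [seq x^-1 | x <- s] ->
  \sum_(x <- s) f x = 2 * \sum_(x <- s | 1 < x) f x /\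
  count (fun x => x < 1) s = count (fun x => 1 < x) s.
Proof.
move=> f1 fV ps.
have lt1 x : x \in s -> (x^-1 < 1) = (1 < x).
  by move=> /fV[x0 _]; rewrite invf_lt1.
split; last first.
  rewrite (permP ps) count_map; apply: eq_in_count => x xs /=.
  by rewrite lt1.
have E : \sum_(x <- s | x < 1) f x = \sum_(x <- s | 1 < x) f x.
  rewrite (perm_big _ ps) /= big_map big_seq_cond [RHS]big_seq_cond.
  apply: eq_big => [x|x /andP[xs _]]; last by case: (fV x xs).
  by case xs : (x \in s) => //=; rewrite lt1.
rewrite (bigID (fun x => 1 < x)) /= mulr_natl mulr2n; congr (_ + _).
rewrite -E (bigID (fun x => x < 1)) /= [X in _ + X]big1 ?addr0.
  apply: eq_bigl => x; rewrite -leNgt andb_idl //; exact: ltW.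
by move=> x; rewrite -leNgt -leNgt -eq_le => /eqP ->.
Qed.

(** * Pseudo-unitary matrices *)

Section pseudo_unitary.
Variables (R : realType) (c d : nat).
Local Notation C := R[i].
Local Notation m := (c + d)%N.
Local Notation G := (Gmx R c d).
Implicit Types T S : 'M[C]_m.

Lemma Gmx_sqr : G *m G = 1%:M.
Proof.
rewrite /Gmx mulmx_block !mulmx0 !mul0mx !addr0 !add0r mul1mx mulmxN mulmx1 opprK.
by rewrite -scalar_mx_block.
Qed.

Lemma adjmxM (k l n : nat) (A : 'M[C]_(k, l)) (B : 'M[C]_(l, n)) :
  (A *m B) ^t* = B ^t* *m A ^t*.
Proof. by rewrite trmx_mul map_mxM. Qed.

Lemma det_adjmx (n : nat) (A : 'M[C]_n) : \det (A ^t*) = (\det A)^*%R.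
Proof. by rewrite det_map_mx det_tr. Qed.

Lemma Ugrp_mul T S : Ugrp R c d T -> Ugrp R c d S -> Ugrp R c d (T *m S).
Proof.
move=> hT hS; rewrite /Ugrp /= adjmxM.
have -> : S ^t* *m T ^t* *m G *m (T *m S) = S ^t* *m (T ^t* *m G *m T) *m S.
  by rewrite !mulmxA.
by rewrite hT hS.
Qed.

Lemma Ugrp1 : Ugrp R c d 1%:M.
Proof. by rewrite /Ugrp /= trmx1 map_mx1 mulmx1 mul1mx. Qed.

Lemma Ugrp_inv T : Ugrp R c d T -> T *m (G *m T ^t* *m G) = 1%:M.
Proof.
move=> hT; apply: mulmx1C.
have -> : G *m T ^t* *m G *m T = G *m (T ^t* *m G *m T) by rewrite !mulmxA.
by rewrite hT Gmx_sqr.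
Qed.

(** This says that [U(c,d)] is stable under conjugate transposition. *)
Lemma Ugrp_dual T : Ugrp R c d T -> T *m G *m T ^t* = G.
Proof.
move=> /Ugrp_inv /(congr1 (mulmx^~ G)).
by rewrite -!mulmxA Gmx_sqr mulmx1 mul1mx.
Qed.

Lemma det_Gmx : \det G = (-1) ^+ d.
Proof.
by rewrite /Gmx det_ublock det1 mul1r -scaleN1r detZ det1 mulr1.
Qed.

Lemma norm_det_Ugrp T : Ugrp R c d T -> `|\det T| = 1.
Proof.
move=> /(congr1 (fun A => \det A)); rewrite !det_mulmx det_adjmx det_Gmx => E.
have : `|\det T| ^+ 2 = 1.
  rewrite normCK; apply: (@mulIf _ ((-1) ^+ d)); first by rewrite signr_eq0.
  by rewrite mul1r -[RHS]E; ring.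
by move=> /eqP; rewrite sqrp_eq1 // => /eqP.
Qed.

Lemma adj_block_mx (A : 'M[C]_c) (B : 'M[C]_(c, d)) (D : 'M[C]_(d, c)) (E : 'M[C]_d) :
  (block_mx A B D E) ^t* = block_mx (A ^t*) (D ^t*) (B ^t*) (E ^t*).
Proof. by rewrite tr_block_mx map_block_mx. Qed.

(* The first block column of [T *m T^-1 = 1], with [T^-1 = G *m T^* *m G]. *)
Lemma det_ulsubmx_Ugrp T : Ugrp R c d T ->
  \det T * (\det (ulsubmx T))^*%R = \det (drsubmx T).
Proof.
move=> /Ugrp_inv.
rewrite -{1 2}(submxK T); set A := ulsubmx T; set B := ursubmx T.
set D := dlsubmx T; set E := drsubmx T.
rewrite adj_block_mx /Gmx !(mulmx_block, mulmx0, mul0mx, mulmx1, mul1mx, addr0, add0r).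
rewrite !(mulmxN, mulNmx, mulmx1, mul1mx, opprK) scalar_mx_block => /eq_block_mx.
move=> [e1 _ e2 _].
(* The first block column of the inverse is completed by the second one of the identity, so that
   multiplying by [T] leaves a block triangular matrix with diagonal [1, E]. *)
have -> : \det T * (\det A)^*%R = \det (T *m block_mx (A ^t*) 0 (- (B ^t*)) 1%:M).
  by rewrite det_mulmx det_lblock det1 mulr1 det_adjmx.
rewrite -[T]submxK mulmx_block !mulmx0 !mulmx1 !add0r !mulmxN.
by rewrite -/A -/B -/D -/E e1 e2 det_ublock det1 mul1r.
Qed.

Lemma norm_det_ulsubmx T : Ugrp R c d T -> `|\det (ulsubmx T)| = `|\det (drsubmx T)|.
Proof.
move=> hT; rewrite -(det_ulsubmx_Ugrp hT) normrM (norm_det_Ugrp hT) mul1r.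
by rewrite norm_conjC.
Qed.

(** The off-diagonal blocks of [T G + G T] cancel, and its diagonal blocks are, up to sign, twice
    those of [T], whose determinants have equal modulus by [norm_det_ulsubmx]; hence the square. *)
Lemma norm_det_add1_gram T : Ugrp R c d T ->
  `|\det (1%:M + T ^t* *m T)| = 2 ^+ m * `|\det (drsubmx T)| ^+ 2.
Proof.
move=> hT.
have E : T *m G *m (1%:M + T ^t* *m T) =
    block_mx (2 *: ulsubmx T) 0 0 (- 2 *: drsubmx T).
  rewrite mulmxDr mulmx1 mulmxA (Ugrp_dual hT) -[in LHS](submxK T) /Gmx.
  rewrite !mulmx_block !mulmx0 !mul0mx !mulmx1 !mul1mx !addr0 !add0r.
  rewrite !(mulmxN, mulNmx, mulmx1, mul1mx) add_block_mx subrr addNr.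
  by rewrite scaleNr !scaler_nat !mulr2n opprD.
have := congr1 (fun A => `|\det A|) E.
rewrite !det_mulmx !normrM (norm_det_Ugrp hT) det_Gmx normr_sign !mul1r => ->.
rewrite det_ublock !detZ !normrM (norm_det_ulsubmx hT) !normrX normrN.
by rewrite normr_nat exprD expr2; ring.
Qed.

Local Notation H T := (T ^t* *m T).
Local Notation lam T := (spectral_diag (H T)).

Lemma spectral_gram (n : nat) (T : 'M[C]_n) :
  H T = (spectralmx (H T)) ^t* *m diag_mx (lam T) *m spectralmx (H T).
Proof.
have hn : H T \is normalmx by apply/normalmxP; rewrite adjmxM trmxCK.
rewrite -invmx_unitary ?spectral_unitarymx //.
exact: (orthomx_spectralP hn).
Qed.

(** In an eigenbasis [P], the diagonal matrix of eigenvalues is the Gram matrix of [T *m P ^t*], so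
    its diagonal entries are sums of squared moduli. *)
Lemma spectral_gram_ge0 (n : nat) (T : 'M[C]_n) i : 0 <= lam T 0 i.
Proof.
set P := spectralmx (H T).
have PP : P *m P ^t* = 1%:M by apply/unitarymxP/spectral_unitarymx.
have E : diag_mx (lam T) = (T *m P ^t*) ^t* *m (T *m P ^t*).
  rewrite adjmxM trmxCK; have -> : P *m T ^t* *m (T *m P ^t*) = P *m H T *m P ^t*.
    by rewrite !mulmxA.
  by rewrite [in RHS]spectral_gram -/P !mulmxA PP mul1mx -mulmxA PP mulmx1.
have := congr1 (fun A : 'M[C]_n => A i i) E; rewrite !mxE eqxx mulr1n => ->.
by apply: sumr_ge0 => k _; rewrite !mxE mulrC mul_conjC_ge0.
Qed.

Lemma det_gram_add1 (n : nat) (T : 'M[C]_n) :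
  \det (1%:M + H T) = \prod_i (1 + lam T 0 i).
Proof.
set P := spectralmx (H T).
have PP : P *m P ^t* = 1%:M by apply/unitarymxP/spectral_unitarymx.
have E : P *m (1%:M + H T) = diag_mx (const_mx 1 + lam T) *m P.
  rewrite mulmxDr mulmx1 [in LHS]spectral_gram -/P !mulmxA PP mul1mx.
  by rewrite raddfD /= mulmxDl diag_const_mx mul1mx.
have Pu : P \in unitmx by exact: spectral_unit.
have := congr1 (fun A => \det A) E; rewrite !det_mulmx [RHS]mulrC.
move/mulfI => ->; last by rewrite -unitfE -unitmxE.
by rewrite det_diag; apply: eq_bigr => i _; rewrite !mxE.
Qed.

Lemma det_gram (n : nat) (T : 'M[C]_n) : `|\det T| ^+ 2 = \prod_i lam T 0 i.
Proof.
set P := spectralmx (H T).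
have PP : P *m P ^t* = 1%:M by apply/unitarymxP/spectral_unitarymx.
have E : P *m H T = diag_mx (lam T) *m P.
  by rewrite [in LHS]spectral_gram -/P !mulmxA PP mul1mx.
have Pu : P \in unitmx by exact: spectral_unit.
have := congr1 (fun A => \det A) E; rewrite !det_mulmx [RHS]mulrC.
move/mulfI => /(_ _)/esym; rewrite det_diag => ->; last by rewrite -unitfE -unitmxE.
by rewrite det_adjmx normCK mulrC.
Qed.

End pseudo_unitary.

(** * Singular values of pseudo-unitary matrices *)

Section Nfun_Ugrp.
Variables (R : realType) (c d : nat).
Local Notation C := R[i].
Local Notation m := (c + d)%N.
Local Notation G := (Gmx R c d).
Implicit Types T : 'M[C]_m.
Local Notation H T := (T ^t* *m T).
Local Notation lam T := (spectral_diag (H T)).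
(* The squares of the singular values of [T]. *)
Local Notation sv2 T i := (complex.Re (lam T 0 i)).

Lemma spectral_gramE (n : nat) (T : 'M[C]_n) i : lam T 0 i = (sv2 T i)%:C.
Proof. by apply/esym/RRe_real/ger0_real/spectral_gram_ge0. Qed.

Lemma prod_sv2 T : Ugrp R c d T -> \prod_i sv2 T i = 1.
Proof.
move=> hT; apply: (@complexI R); rewrite rmorph_prod rmorph1 /=.
transitivity (`|\det T| ^+ 2); last by rewrite norm_det_Ugrp // expr1n.
by rewrite det_gram; apply: eq_bigr => i _; rewrite spectral_gramE.
Qed.

Lemma sv2_gt0 T i : Ugrp R c d T -> 0 < sv2 T i.
Proof.
move=> hT; rewrite lt_neqAle -ler0c -spectral_gramE spectral_gram_ge0 andbT eq_sym.
have /prodf_neq0/(_ i isT) // : \prod_i sv2 T i != 0 by rewrite prod_sv2 // oner_eq0.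
Qed.

Lemma spectral_gram_neq0 T i : Ugrp R c d T -> lam T 0 i != 0.
Proof.
by move=> hT; rewrite spectral_gramE (inj_eq (@complexI R)) gt_eqF // sv2_gt0.
Qed.

Lemma spectral_gramr (n : nat) (T : 'M[C]_n) :
  spectralmx (H T) *m H T = diag_mx (lam T) *m spectralmx (H T).
Proof.
have PP : spectralmx (H T) *m (spectralmx (H T)) ^t* = 1%:M.
  exact/unitarymxP/spectral_unitarymx.
by rewrite [X in _ *m X = _]spectral_gram !mulmxA PP mul1mx.
Qed.

(** [H = T^* T] is Hermitian and lies in [U(c,d)], so its inverse is [G H G], which is similar to
    [H]. Comparing characteristic polynomials keeps track of multiplicities. *)
Lemma perm_spectral_gramV T : Ugrp R c d T ->
  perm_eq [seq lam T 0 i | i : 'I_m] [seq (lam T 0 i)^-1 | i : 'I_m].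
Proof.
move=> hT; apply: prod_XsubC_eq; rewrite !big_image /=.
have hTt : Ugrp R c d (T ^t*) by rewrite /Ugrp /= trmxCK Ugrp_dual.
have HV := Ugrp_inv (Ugrp_mul hTt hT).
have HVE : (H T) ^t* = H T by rewrite adjmxM trmxCK.
rewrite HVE in HV.
set P := spectralmx (H T); pose mu : 'rV[C]_m := \row_i (lam T 0 i)^-1.
have PH : P *m H T = diag_mx (lam T) *m P by exact: spectral_gramr.
have Pu : P \in unitmx by exact: spectral_unit.
(* Since [H G H = G], the basis [P G] diagonalizes [H] as well, with the inverse eigenvalues. *)
have PG : (P *m G) *m H T = diag_mx mu *m (P *m G).
  have mulam : diag_mx mu *m diag_mx (lam T) = 1%:M.
    rewrite mulmx_diag -diag_const_mx; congr diag_mx; apply/rowP => i.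
    by rewrite !mxE mulVf // spectral_gram_neq0.
  have HGH : H T *m (G *m H T) = G.
    by rewrite -[RHS]mul1mx -HV -!mulmxA Gmx_sqr mulmx1.
  rewrite -[P in LHS]mul1mx -mulam -(mulmxA (diag_mx mu)) -PH.
  by rewrite -!mulmxA in HGH *; rewrite HGH.
have PGu : P *m G \in unitmx by rewrite unitmx_mul Pu; case/mulmx1_unit: (Gmx_sqr R c d).
have := char_poly_similar PGu PG; rewrite (char_poly_similar Pu PH).
rewrite !char_poly_trig ?diag_mx_is_trig // => E.
transitivity (\prod_i ('X - (diag_mx (lam T) i i)%:P)).
  by apply: eq_bigr => i _; rewrite !mxE eqxx mulr1n.
by rewrite E; apply: eq_bigr => i _; rewrite !mxE eqxx mulr1n.
Qed.

(* [T^* T - 1 = 2 (T^* P T - P)] for both P = diag(1, 0) and P = diag(0, 1). *)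
Lemma rank_gram_sub1 T : Ugrp R c d T -> (\rank (H T - 1%:M)%R <= 2 * minn c d)%N.
Proof.
move=> hT.
pose Pl : 'M[C]_m := block_mx 1%:M 0 0 0; pose Pr : 'M[C]_m := block_mx 0 0 0 1%:M.
have PlE : Pl + Pr = 1%:M by rewrite add_block_mx !addr0 !add0r -scalar_mx_block.
have PrE : Pl - Pr = G.
  by rewrite /Gmx opp_block_mx add_block_mx !oppr0 !addr0 !add0r.
have rl : (\rank Pl <= c)%N.
  have -> : Pl = col_mx 1%:M 0 *m row_mx 1%:M 0.
    by rewrite mul_col_row !mulmx0 !mul0mx mulmx1.
  exact: mulmx_max_rank.
have rr : (\rank Pr <= d)%N.
  have -> : Pr = col_mx 0 1%:M *m row_mx 0 1%:M.
    by rewrite mul_col_row !mulmx0 !mul0mx mulmx1.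
  exact: mulmx_max_rank.
have tPlT : T ^t* *m Pl *m T - T ^t* *m Pr *m T = Pl - Pr.
  by rewrite -mulmxBl -mulmxBr PrE.
have HE : H T = T ^t* *m Pl *m T + T ^t* *m Pr *m T.
  by rewrite -mulmxDl -mulmxDr PlE mulmx1.
have e1 : H T - 1%:M = (T ^t* *m (2 *: Pl)) *m T - 2 *: Pl.
  rewrite -scalemxAr -scalemxAl !scaler_nat !mulr2n -PlE HE.
  have -> : T ^t* *m Pr *m T = T ^t* *m Pl *m T - (Pl - Pr) by rewrite -tPlT subKr.
  move: (_ *m Pl *m _) => X.
  by apply/matrixP => i j; rewrite ![in LHS]mxE ![in RHS]mxE; ring.
have e2 : H T - 1%:M = (T ^t* *m (2 *: Pr)) *m T - 2 *: Pr.
  rewrite -scalemxAr -scalemxAl !scaler_nat !mulr2n -PlE HE.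
  have -> : T ^t* *m Pl *m T = T ^t* *m Pr *m T + (Pl - Pr).
    by rewrite -tPlT addrC subrK.
  move: (_ *m Pr *m _) => X.
  by apply/matrixP => i j; rewrite ![in LHS]mxE ![in RHS]mxE; ring.
(* Both terms have rank at most that of [Q], which gives the factor 2. *)
have rk (Q : 'M[C]_m) k : (\rank Q <= k)%N ->
    (\rank ((T ^t* *m (2 *: Q)) *m T - 2 *: Q)%R <= 2 * k)%N.
  move=> rQ; apply: leq_trans (mxrank_add _ _) _; rewrite mul2n -addnn; apply: leq_add.
    apply: leq_trans (mxrankM_maxl _ _) _; apply: leq_trans (mxrankM_maxr _ _) _.
    by apply: leq_trans rQ; apply: mxrankS; exact: scalemx_sub.
  by rewrite mxrank_opp; apply: leq_trans rQ; apply: mxrankS; exact: scalemx_sub.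
by rewrite minnMr leq_min {1}e1 e2 !rk.
Qed.

Lemma ln_sqrt (x : R) : 0 < x -> ln (Num.sqrt x) = ln x / 2.
Proof.
move=> x0; rewrite -[in RHS](sqr_sqrtr (ltW x0)) expr2 lnM ?posrE ?sqrtr_gt0 //.
by field.
Qed.

Lemma ln_prod (I : finType) (F : I -> R) : (forall i, 0 < F i) ->
  ln (\prod_i F i) = \sum_i ln (F i).
Proof.
move=> F0; suff [] : 0 < \prod_i F i /\ ln (\prod_i F i) = \sum_i ln (F i) by [].
apply: (big_rec2 (fun x y => 0 < x /\ ln x = y)) => [|i x y _ [x0 <-]].
  by rewrite ln1.
by rewrite mulr_gt0 // lnM ?posrE.
Qed.

Lemma normC_normc (z : C) : `|z| = (normc z)%:C.
Proof. by []. Qed.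

Lemma prod_add1_sv2 T : Ugrp R c d T ->
  \prod_i (1 + sv2 T i) = 2 ^+ m * normc (\det (drsubmx T)) ^+ 2.
Proof.
move=> hT; apply: (@complexI R); rewrite rmorph_prod rmorphM !rmorphXn /= -normC_normc.
rewrite rmorph_nat -norm_det_add1_gram // det_gram_add1 ger0_norm.
  by apply: eq_bigr => i _; rewrite rmorphD rmorph1 /= spectral_gramE.
by apply: prodr_ge0 => i _; rewrite addr_ge0 // spectral_gram_ge0.
Qed.

Lemma det_drsubmx_gt0 T : Ugrp R c d T -> 0 < normc (\det (drsubmx T)).
Proof.
move=> hT; rewrite normc_gt0; apply/negP => /eqP D0.
have := prod_add1_sv2 hT; rewrite D0 ComplexField.Normc.normc0 expr0n mulr0 => /eqP.
by apply/negP; apply/prodf_neq0 => i _; rewrite gt_eqF // addr_gt0 // sv2_gt0.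
Qed.

(** The [d] largest singular values include all those above 1; these carry half of the sum of [f]
    over all singular values, and that full sum is [2 ln |det D|]. *)
Lemma Nfun_Ugrp T : Ugrp R c d T -> Nfun d T = ln (normc (\det (drsubmx T))).
Proof.
move=> hT; rewrite /Nfun.
pose f (x : R) : R := ln ((x + x^-1) / 2).
rewrite -/(singular_values T).
set s0 := [seq Num.sqrt (sv2 T i) | i : 'I_m].
have s0P x : x \in s0 -> exists i, x = Num.sqrt (sv2 T i).
  by move=> /mapP[i _ ->]; exists i.
have ps : perm_eq (singular_values T) s0 by rewrite perm_sort.
have f1 : f 1 = 0 by rewrite /f invr1 divff ?ln1 // pnatr_eq0.
have fV : {in s0, forall x, 0 < x /\ f x^-1 = f x}.
  move=> x /s0P[i ->]; rewrite sqrtr_gt0 sv2_gt0 //; split=> //.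
  by rewrite /f invrK addrC.
have pV : perm_eq s0 [seq x^-1 | x <- s0].
  have := perm_map (fun z : C => Num.sqrt (complex.Re z)) (perm_spectral_gramV hT).
  rewrite -map_comp; congr perm_eq; rewrite /s0 /image_mem -!map_comp.
  apply: eq_map => i /=.
  by rewrite -sqrtrV ?ltW ?sv2_gt0 // spectral_gramE -fmorphV.
have [sumE countE] := sum_gt1_half f1 fV pV.
(* The singular values different from 1 are the nonzero eigenvalues of [T^* T - 1], so its rank
   bounds their number. *)
have card_ne1 : (count (fun x : R => (1 < x)%R) s0 + count (fun x : R => (x < 1)%R) s0
    <= 2 * minn c d)%N.
  apply: leq_trans (rank_gram_sub1 hT).
  set P := spectralmx (H T).
  have Pu : P \in unitmx by exact: spectral_unit.
  have E : P *m (H T - 1%:M) = diag_mx (lam T - const_mx 1) *m P.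
    by rewrite mulmxBr mulmx1 spectral_gramr raddfB /= mulmxBl diag_const_mx mul1mx.
  rewrite -[(\rank (_ - _)%R)](eqmxMfull _ (_ : row_full P)) ?row_full_unit //.
  rewrite E mxrankMfree ?row_free_unit //.
  apply: leq_trans (card_support_le_rank_diag _).
  have -> : (count (fun x : R => (1 < x)%R) s0 + count (fun x : R => (x < 1)%R) s0 =
             count (fun x : R => x != 1%R) s0)%N.
    rewrite -count_predUI [X in (_ + X)%N](_ : _ = 0%N) ?addn0.
      by apply: eq_count => x /=; rewrite neq_lt orbC.
    by apply/eqP; rewrite -leqn0 leqNgt -has_count; apply/hasPn => x _ /=; case: ltgtP.
  rewrite count_map -sum1_count -sum1_card big_enum_cond /=; apply/eq_leq/eq_bigl => i.
  rewrite !inE !mxE subr_eq0 spectral_gramE (inj_eq (@complexI R) _ 1); congr negb.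
  apply/eqP/eqP => [q1|->]; last exact: sqrtr1.
  by rewrite -(sqr_sqrtr (ltW (sv2_gt0 i hT))) q1 expr1n.
(* Inversion makes the counts above and below 1 equal, so each is at most half the rank bound. *)
have count_le : (count (fun x : R => (1 < x)%R) s0 <= minn c d)%N.
  by move: card_ne1; rewrite countE addnn -mul2n leq_pmul2l.
have szs : size (singular_values T) = (c + d)%N.
  by rewrite (perm_size ps) size_map -cardE card_ord.
rewrite (sum_nth_gt1 (c := c) f1) //; first last.
- by rewrite (permP ps) countE (leq_trans count_le) // geq_minl.
- by rewrite (permP ps) (leq_trans count_le) // geq_minr.
- by apply: sort_sorted => x y; exact: le_total.
rewrite (perm_big _ ps) /=; apply: (@mulfI _ 2); first by rewrite pnatr_eq0.
rewrite -sumE big_image /=.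
(* For a singular value s, [(s + 1/s)/2 = ((1 + s^2)/2)/s]; the terms [ln s] sum to 0 because the
   [sv2 T i] have product 1. *)
have fE i : f (Num.sqrt (sv2 T i)) = ln ((1 + sv2 T i) / 2) - ln (sv2 T i) / 2.
  have l0 := sv2_gt0 i hT.
  rewrite -ln_sqrt // -ln_div ?posrE ?sqrtr_gt0 // ?divr_gt0 ?ltr0n ?addr_gt0 //.
  have q0 : Num.sqrt (sv2 T i) != 0 by rewrite gt_eqF // sqrtr_gt0.
  congr ln; rewrite -[X in 1 + X](sqr_sqrtr (ltW l0)).
  by field.
rewrite (eq_bigr _ (fun i _ => fE i)) big_split /= sumrN -mulr_suml.
rewrite -!ln_prod ?(prod_sv2 hT) ?ln1 ?mul0r ?subr0.
rewrite prodf_div prodr_const card_ord.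
rewrite prod_add1_sv2 //; set w := normc _.
have w0 : 0 < w by exact: det_drsubmx_gt0.
have -> : (2 ^+ m * w ^+ 2) / 2 ^+ m = w ^+ 2.
  by rewrite mulrAC divff ?mul1r // expf_neq0 ?pnatr_eq0.
by rewrite expr2 lnM ?posrE // mulr_natl mulr2n.
all: try by move=> i; exact: sv2_gt0.
by move=> i; rewrite divr_gt0 ?ltr0n // addr_gt0 ?sv2_gt0.
Qed.

End Nfun_Ugrp.

(** * Minors *)

Section minors.
Variables (R : realType).
Local Notation C := R[i].

Lemma ext_powerM (r m : nat) (A B : 'M[C]_m) :
  ext_power r (A *m B) = ext_power r A *m ext_power r B.
Proof.
apply/matrixP => s t; rewrite !mxE mxsub_mul Cauchy_Binet [LHS]big_enum_val /=.
by apply: eq_bigr => k _; rewrite !mxE -!mxsub_comp.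
Qed.

Lemma det_gram_diag (r m : nat) (Y : 'M[C]_(m, r)) (v : 'rV[C]_m) :
  \det (Y ^t* *m diag_mx v *m Y) =
  \sum_(s in wedge_index r m) `|\det (rowsub (tnth s) Y)| ^+ 2 * \prod_i v 0 (tnth s i).
Proof.
rewrite Cauchy_Binet; apply: eq_bigr => s _.
have -> : colsub (tnth s) (Y ^t* *m diag_mx v) =
          (rowsub (tnth s) Y) ^t* *m diag_mx (\row_i v 0 (tnth s i)).
  by apply/matrixP => i j; rewrite !mul_mx_diag !mxE.
rewrite det_mulmx det_adjmx det_diag normCK mulrAC [_ * \det _]mulrC.
by congr (_ * _); apply: eq_bigr => i _; rewrite mxE.
Qed.

Lemma det_gram_sub (r m : nat) (Y : 'M[C]_(m, r)) :
  \det (Y ^t* *m Y) = \sum_(s in wedge_index r m) `|\det (rowsub (tnth s) Y)| ^+ 2.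
Proof.
rewrite -[Y ^t*]mulmx1 -diag_const_mx det_gram_diag; apply: eq_bigr => s _.
by rewrite big1 ?mulr1 // => i _; rewrite mxE.
Qed.

(* Cauchy-Binet bounds the minor by a principal minor of [T^* T], then expands the
   latter over products of [r] distinct eigenvalues. *)
Lemma norm_minor_le (r m : nat) (T : 'M[C]_m) (s t : 'I_#|wedge_index r m|) :
  `|ext_power r T s t| ^+ 2 <= \prod_i (1 + spectral_diag (T ^t* *m T) 0 i).
Proof.
set lam := spectral_diag _; set P := spectralmx (T ^t* *m T).
have lam0 i : 0 <= lam 0 i by exact: spectral_gram_ge0.
pose X := colsub (tnth (enum_val t)) T; pose Y := colsub (tnth (enum_val t)) P.
have adj_colsub (A : 'M[C]_m) : (colsub (tnth (enum_val t)) A) ^t* =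
    rowsub (tnth (enum_val t)) (A ^t*) by apply/matrixP => i j; rewrite !mxE.
have XY : X ^t* *m X = Y ^t* *m diag_mx lam *m Y.
  by rewrite !adj_colsub [in RHS]mul_rowsub_mx -!mxsub_mul -spectral_gram.
have winj (k : r.-tuple 'I_m) : k \in wedge_index r m -> injective (tnth k).
  move=> kW; apply/tuple_uniqP; move: kW.
  by rewrite inE => /(sorted_uniq ltn_trans ltnn); rewrite (map_inj_uniq val_inj).
have YY : Y ^t* *m Y = 1%:M.
  have PP : P ^t* *m P = 1%:M by apply/mulmx1C/unitarymxP/spectral_unitarymx.
  rewrite !adj_colsub -!mxsub_mul PP; apply/matrixP => i j; rewrite !mxE.
  by rewrite (inj_eq (winj _ (enum_valP t))).
have <- : \det (rowsub (tnth (enum_val s)) X) = ext_power r T s t.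
  by rewrite mxE -mxsub_comp.
apply: (@le_trans _ _ (\det (X ^t* *m X))).
  rewrite det_gram_sub (bigD1 (enum_val s)) ?enum_valP //= lerDl.
  by apply: sumr_ge0 => k _; rewrite exprn_ge0.
have prod_ge0 : 0 <= \prod_i (1 + lam 0 i) by apply: prodr_ge0 => i _; rewrite addr_ge0.
set p := \prod_i _ in prod_ge0 *.
(* As [det (Y^* Y) = 1], the squared minors of [Y] are weights of total 1; it suffices to bound each
   product of [r] eigenvalues. *)
rewrite XY det_gram_diag -[leRHS]mul1r -[1 in leRHS](det1 _ r) -YY det_gram_sub mulr_suml.
apply: ler_sum => k kW; apply: ler_wpM2l; first by rewrite exprn_ge0.
have kinj := winj _ kW.
(* The factors indexed by [k] dominate the chosen eigenvalues, and the remaining ones are at least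
   1. *)
rewrite /p [leRHS](bigID [pred i | i \in codom (tnth k)]) /= -[leLHS]mulr1.
apply: ler_pM => //.
- by apply: prodr_ge0.
- rewrite -big_uniq ?map_inj_uniq -?enumT ?enum_uniq //= /codom big_image /=.
  by apply: ler_prod => i _; rewrite lam0 lerDr ler01.
- apply: (big_ind (fun x : C => 1 <= x)) => [//|x y|i _]; first exact: mulr_ege1.
  by rewrite lerDl.
Qed.

End minors.

(** * Growth of matrix powers *)

Section growth.
Variables (R : realType).
Local Notation C := R[i].

(* With [x k = A^k B], [x k.+1 = lambda x k + A^k (A - lambda) B], and the
   last term is handled by induction. *)
Lemma norm_expmx_le (N : nat) (A : 'M[C]_N.+1) (r : R) (s : seq C) i j :
    (forall l, l \in s -> normc l < r) ->
  forall B : 'M[C]_N.+1, horner_mx A (\prod_(l <- s) ('X - l%:P)) * B = 0 ->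
  exists K : R, forall k, normc ((A ^+ k * B) i j) <= K * r ^+ k.
Proof.
elim: s => [|l s IH] sr B.
  rewrite big_nil rmorph1 mul1r => ->; exists 0 => k.
  by rewrite mulr0 mxE mul0r ComplexField.Normc.normc0.
have lr : normc l < r by apply: sr; rewrite mem_head.
have r0 : 0 < r by exact: le_lt_trans (normc_ge0 _) lr.
(* Moving the factor of [l] next to [B] lets the induction hypothesis apply to [(A - l) B]. *)
rewrite big_cons mulrC rmorphM /= -mulrA rmorphB /= horner_mx_X horner_mx_C => /IH.
case=> [k ks|K KP]; first by apply: sr; rewrite inE ks orbT.
have K0 : 0 <= K.
  have := KP 0%N; rewrite expr0 mulr1; apply: le_trans; exact: normc_ge0.
(* The second summand solves [x r = K + |l| x], which closes the recursion; the first one covers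
   [k = 0]. *)
exists (normc (B i j) + K / (r - normc l)); elim=> [|k IHk].
  by rewrite expr0 mul1r mulr1 lerDl divr_ge0 // subr_ge0 ltW.
have -> : (A ^+ k.+1 * B) i j =
    (A ^+ k * ((A - l%:M) * B)) i j + l * (A ^+ k * B) i j.
  have -> : A ^+ k.+1 * B = A ^+ k * ((A - l%:M) * B) + l%:M * (A ^+ k * B).
    rewrite mulrBl mulrBr exprSr !mulrA.
    have -> : A ^+ k * l%:M = l%:M * A ^+ k by exact: scalar_mxC.
    by rewrite subrK.
  by rewrite mxE; congr (_ + _); rewrite [_%:M * _]mul_scalar_mx mxE.
apply: le_trans (le_normcD _ _) _; rewrite ComplexField.Normc.normcM.
apply: le_trans (lerD (KP k) (ler_wpM2l (normc_ge0 l) IHk)) _.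
rewrite exprS !mulrA -mulrDl ler_pM2r ?exprn_gt0 //.
have rl : r - normc l != 0 by rewrite subr_eq0 gt_eqF.
set b := normc (B i j); have b0 : 0 <= b by exact: normc_ge0.
have -> : (b + K / (r - normc l)) * r =
  K + normc l * (b + K / (r - normc l)) + b * (r - normc l) by field.
by rewrite lerDl mulr_ge0 // subr_ge0 ltW.
Qed.

(** After taking logarithms and dividing by [k.+1], the constants of both bounds vanish in the
    limit, and [r] may be taken arbitrarily close to [rho]. *)
Lemma cvg_ln_growth (a : nat -> R) (rho : R) : 0 < rho -> (forall k, 0 < a k) ->
    (exists K, forall k, rho ^+ k.+1 <= K * a k) ->
    (forall r, rho < r -> exists K, forall k, a k <= K * r ^+ k.+1) ->
  (fun k => ln (a k) / k.+1%:R) @ \oo --> ln rho.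
Proof.
move=> rho0 a0 [K KP] up; apply/cvgrPdist_le => /= e e0.
(* This [r] exceeds [rho] by [e / 2] on the logarithmic scale; the other half of [e] absorbs [ln K]
   and [ln L]. *)
have [|L LP] := up (rho * expR (e / 2)).
  by rewrite ltr_pMr // -expR0 ltr_expR divr_gt0 // ltr0n.
have K0 : 0 < K.
  by rewrite -(pmulr_lgt0 _ (a0 0%N)) (lt_le_trans _ (KP 0%N)) // exprn_gt0.
have re0 : 0 < rho * expR (e / 2) by rewrite mulr_gt0 // expR_gt0.
have L0 : 0 < L.
  by rewrite -(pmulr_lgt0 _ (exprn_gt0 1 re0)) (lt_le_trans (a0 0%N)).
have lnX x k : 0 < x -> ln (x ^+ k.+1) = k.+1%:R * ln x.
  by move=> x0; rewrite lnXn // mulr_natl.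
near=> k.
have kpos : 0 < k.+1%:R :> R by rewrite ltr0n.
have M : (`|ln K| + `|ln L|) / k.+1%:R <= e / 2.
  rewrite ler_pdivrMr // mulrC -ler_pdivrMr ?divr_gt0 //.
  apply: (@le_trans _ _ k%:R); last by rewrite ler_nat.
  by near: k; exact: nbhs_infty_ger.
have lo : k.+1%:R * ln rho <= ln K + ln (a k).
  by rewrite -lnX // -lnM ?posrE // ler_ln ?posrE ?mulr_gt0 ?exprn_gt0.
have hi : ln (a k) <= ln L + k.+1%:R * (ln rho + e / 2).
  rewrite -[e / 2]expRK -lnM ?posrE ?expR_gt0 // -lnX // -lnM ?posrE ?exprn_gt0 //.
  by rewrite ler_ln ?posrE ?mulr_gt0 ?exprn_gt0.
have lK := ler_norm (ln K); have lL := ler_norm (ln L).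
have nK := normr_ge0 (ln K); have nL := normr_ge0 (ln L).
rewrite ler_pdivrMr // in M.
rewrite -(ler_pM2r kpos) -[X in _ * X <= _]gtr0_norm // -normrM mulrBl divfK ?gt_eqF //.
by rewrite ler_norml; apply/andP; split; lra.
Unshelve. all: by end_near.
Qed.

End growth.

(** * Spectral radius as a growth rate *)

Section gelfand.
Variables (R : realType).
Local Notation C := R[i].

Lemma seq_argmax (T : eqType) (f : T -> R) (x0 : T) (s : seq T) : x0 \in s ->
  exists2 x, x \in s & {in s, forall y, f y <= f x}.
Proof.
elim: s x0 => // a s IH x0 _; case: s IH => [_|b s IH].
  by exists a; rewrite ?mem_head // => y; rewrite inE => /eqP ->.
have [|x xs xP] := IH b; first by rewrite mem_head.
have [ax|xa] := leP (f a) (f x).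
  exists x; first by rewrite inE xs orbT.
  by move=> y; rewrite inE => /predU1P[->//|/xP].
exists a; first by rewrite mem_head.
move=> y; rewrite inE => /predU1P[->//|/xP yx].
by apply: le_trans yx _; exact: ltW.
Qed.

(** In positive dimension the eigenvalues form a nonempty finite list, the roots of the
    characteristic polynomial, so the supremum is attained. *)
Lemma spectral_radius_max (N : nat) (A : 'M[C]_N.+1) :
  exists2 l, eigenvalue A l &
    spectral_radius A = normc l /\ (forall k, eigenvalue A k -> normc k <= normc l).
Proof.
have [rs prs] := closed_field_poly_normal (char_poly A).
rewrite (monicP (char_poly_monic A)) scale1r in prs.
have rsP l : eigenvalue A l = (l \in rs).
  by rewrite eigenvalue_root_char prs root_prod_XsubC.
have [l0] := eigenvalue_closed A (ltn0Sn N).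
rewrite rsP => /(@seq_argmax _ (@normc R)) [l lrs lP].
exists l; first by rewrite rsP.
have lmax k : eigenvalue A k -> normc k <= normc l by rewrite rsP => /lP.
split=> //; apply/eqP; rewrite eq_le; apply/andP; split.
  apply: ge_sup; first by exists (normc l); exists l => //=; rewrite rsP.
  by move=> _ [k /= kA <-]; exact: lmax.
apply: ub_le_sup; last by exists l => //=; rewrite rsP.
by exists (normc l) => _ [k /= kA <-]; exact: lmax.
Qed.

Lemma ler_normc_sum (I : finType) (F : I -> C) :
  normc (\sum_i F i) <= \sum_i normc (F i).
Proof.
apply: (big_ind2 (fun x y => normc x <= y)) => //.
  by rewrite ComplexField.Normc.normc0.
by move=> x y z t xy zt; apply: le_trans (le_normcD _ _) _; exact: lerD.
Qed.

Lemma normcX (z : C) k : normc (z ^+ k) = normc z ^+ k.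
Proof.
elim: k => [|k IH]; first by rewrite !expr0 ComplexField.Normc.normc1.
by rewrite !exprS ComplexField.Normc.normcM IH.
Qed.

(** Gelfand's formula with one dominating entry in place of a norm; [M k] is the power [k.+1] of
    [A]. Cayley-Hamilton gives the upper bound through [norm_expmx_le], a left eigenvector of
    maximal eigenvalue the lower one. *)
Lemma cvg_ln_spectral_radius (N : nat) (A : 'M[C]_N) (M : nat -> 'M[C]_N)
    (e : 'I_N) (K : R) :
    M 0%N = A -> (forall k, M k.+1 = A *m M k) ->
    (forall k i j, normc (M k i j) <= K * normc (M k e e)) ->
    (forall k, 1 <= normc (M k e e)) ->
  (fun k => ln (normc (M k e e)) / k.+1%:R) @ \oo --> ln (spectral_radius A).
Proof.
case: N A M e => [A M [] //|N] A M e M0 MS domin ge1.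
have ME k : M k = A ^+ k.+1.
  by elim: k => [|k IH]; rewrite ?M0 ?expr1 // MS IH (exprS A k.+1).
have [l lA [-> lmax]] := spectral_radius_max A.
have gt0 k : 0 < normc (M k e e) by exact: lt_le_trans (ge1 k).
have up r : normc l < r -> exists L, forall k, normc (M k e e) <= L * r ^+ k.+1.
  move=> lr; have [rs prs] := closed_field_poly_normal (char_poly A).
  rewrite (monicP (char_poly_monic A)) scale1r in prs.
  have [||L LP] := @norm_expmx_le R N A r rs e e _ 1.
  - move=> k krs; apply: le_lt_trans lr; apply: lmax.
    by rewrite eigenvalue_root_char prs root_prod_XsubC.
  - by rewrite -prs Cayley_Hamilton mul0r.
  by exists L => k; rewrite ME -[A ^+ _]mulr1.
(* If the radius were 0, the entries would be at most [L / 2^(k+1)], although they are at least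
   1. *)
have l0 : 0 < normc l.
  rewrite normc_gt0; apply/eqP => l0.
  have [|L LP] := up 2^-1; first by rewrite l0 ComplexField.Normc.normc0 invr_gt0 ltr0n.
  have : (fun k => L * 2^-1 ^+ k.+1) @ \oo --> (L * 0 : R).
    apply: cvgM; first exact: cvg_cst.
    rewrite (cvg_shiftS (fun k => 2^-1 ^+ k : R)); apply: cvg_expr.
    by rewrite ger0_norm ?invf_lt1 ?invr_ge0 ?ler0n ?ltr0n // ltr1n.
  rewrite mulr0 => cvg0; have := cvg_lim (@Rhausdorff R) cvg0 => lim0.
  have : (1 : R) <= 0.
    rewrite -[leRHS]lim0; apply: limr_ge; first exact: cvgP cvg0.
    by apply: nearW => k; exact: le_trans (ge1 k) (LP k).
  by rewrite ler10.
apply: cvg_ln_growth => //.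
have /eigenvalueP[v vA v0] := lA.
have vM k : v *m M k = l ^+ k.+1 *: v.
  elim: k => [|k IH]; first by rewrite M0 vA expr1.
  by rewrite MS mulmxA vA -scalemxAl IH scalerA -exprS.
have [j vj] : exists j, v 0 j != 0 by apply/rV0Pn.
(* Coordinate [j] of [v M_k = l^(k+1) v], with every entry of [M_k] bounded by [K] times the
   dominating one. *)
exists ((\sum_i normc (v 0 i)) * K / normc (v 0 j)) => k.
rewrite mulrAC ler_pdivlMr ?normc_gt0 // -normcX.
rewrite -ComplexField.Normc.normcM.
have -> : l ^+ k.+1 * v 0 j = (v *m M k) 0 j by rewrite vM mxE.
rewrite mxE; apply: le_trans (ler_normc_sum _) _.
rewrite -mulrA mulr_suml; apply: ler_sum => i _.
by rewrite ComplexField.Normc.normcM ler_wpM2l // normc_ge0.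
Qed.

End gelfand.

(** * Twisted products *)

Section products.
Variables (R : realType) (c d : nat).
Local Notation C := R[i].
Local Notation m := (c + d)%N.
Local Notation G := (Gmx R c d).
Implicit Types T M : 'M[C]_m.

(** [Umx] with its phase freed to be any complex number, so that products become polynomial in
    [z]. *)
Definition Uz (z : C) : 'M[C]_m := block_mx z%:M 0 0 1%:M.

Definition twisted_prod (L : seq 'M[C]_m) (z : C) : 'M[C]_m :=
  \prod_(T <- L) (Uz z *m T).

Definition sqnorm (k : nat) (x : 'cV[C]_k) : C := (x ^t* *m x) 0 0.

Lemma sqnormE k (x : 'cV[C]_k) : sqnorm x = \sum_i `|x i 0| ^+ 2.
Proof.
by rewrite /sqnorm mxE; apply: eq_bigr => i _; rewrite !mxE normCK mulrC.
Qed.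

Lemma sqnorm_ge0 k (x : 'cV[C]_k) : 0 <= sqnorm x.
Proof. by rewrite sqnormE; apply: sumr_ge0 => i _; rewrite exprn_ge0. Qed.

Lemma sqnorm_gt0 k (x : 'cV[C]_k) : x != 0 -> 0 < sqnorm x.
Proof.
move=> x0; rewrite lt_neqAle sqnorm_ge0 andbT eq_sym; apply: contra x0 => /eqP.
rewrite sqnormE => /psumr_eq0P x0; apply/eqP/colP => i; rewrite mxE.
have /eqP := x0 (fun j _ => exprn_ge0 2 (normr_ge0 (x j 0))) i isT.
by rewrite expf_eq0 /= normr_eq0 => /eqP.
Qed.

Definition Gform (v : 'cV[C]_m) : C := (v ^t* *m G *m v) 0 0.

Lemma Gform_col (u : 'cV[C]_c) (w : 'cV[C]_d) :
  Gform (col_mx u w) = sqnorm u - sqnorm w.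
Proof.
rewrite /Gform /Gmx tr_col_mx map_row_mx mul_row_block mul_row_col.
by rewrite !mulmx0 addr0 add0r mulmx1 mulmxN mulmx1 mulNmx mxE [X in _ + X]mxE.
Qed.

(** The order is that of [R[i]]: the difference of the two values is real and nonnegative. *)
Definition contracting M := forall v, Gform (M *m v) <= Gform v.

Lemma contractingM M T : contracting M -> contracting T -> contracting (M *m T).
Proof. by move=> hM hT v; rewrite -mulmxA; apply: le_trans (hM _) (hT _). Qed.

Lemma contracting_Ugrp T : Ugrp R c d T -> contracting T.
Proof.
move=> hT v; rewrite /Gform adjmxM.
have -> : v ^t* *m T ^t* *m G *m (T *m v) = v ^t* *m (T ^t* *m G *m T) *m v.
  by rewrite !mulmxA.
by rewrite hT.
Qed.

Lemma contracting_Uz z : `|z| <= 1 -> contracting (Uz z).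
Proof.
move=> z1 v; rewrite -[v]vsubmxK /Uz mul_block_col !mul0mx mul1mx addr0 add0r.
rewrite !Gform_col lerD2r mul_scalar_mx !sqnormE; apply: ler_sum => i _.
by rewrite mxE normrM exprMn ler_piMl ?exprn_ge0 // expr_le1.
Qed.

(** A nonzero [w] with [D w = 0] gives the vector [(0, w)] of negative form, whose image has zero
    lower part and hence nonnegative form. *)
Lemma contracting_det M : contracting M -> \det (drsubmx M) != 0.
Proof.
move=> hM; apply/negP; rewrite -det_tr => /det0P[w w0 wM].
have := hM (col_mx 0 w^T); rewrite -[M in Gform (M *m _)]submxK mul_block_col.
have -> : drsubmx M *m w^T = 0 by apply: trmx_inj; rewrite trmx_mul trmxK wM trmx0.
rewrite !mulmx0 !add0r !Gform_col.
have -> : sqnorm (0 : 'cV[C]_c) = 0 by rewrite /sqnorm mulmx0 mxE.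
have -> : sqnorm (0 : 'cV[C]_d) = 0 by rewrite /sqnorm mulmx0 mxE.
have w1 : w^T != 0 by rewrite -(inj_eq (@trmx_inj _ _ _)) trmxK trmx0.
rewrite subr0 sub0r => /(le_trans (sqnorm_ge0 _)).
by rewrite oppr_ge0 lt_geF // sqnorm_gt0.
Qed.

Lemma contracting_twisted L z : (forall T, T \in L -> Ugrp R c d T) ->
  `|z| <= 1 -> contracting (twisted_prod L z).
Proof.
move=> hL z1; rewrite /twisted_prod big_seq.
apply: (big_ind contracting) => [v|M T|T TL]; first by rewrite mul1mx.
  exact: contractingM.
by apply: contractingM; [exact: contracting_Uz|exact/contracting_Ugrp/hL].
Qed.

Lemma Ugrp_Uz z : `|z| = 1 -> Ugrp R c d (Uz z).
Proof.
move=> z1; rewrite /Ugrp /= /Uz adj_block_mx /Gmx !mulmx_block.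
rewrite !tr_scalar_mx !map_scalar_mx !trmx0 !map_mx0 /= conjC1.
rewrite !(mulmx0, mul0mx, addr0, add0r, mulmx1, mul1mx, mulmxN, mulNmx, oppr0).
by rewrite -scalar_mxM mulrC -normCK z1 expr1n.
Qed.

Lemma normC_cis (x : R) : `|cis x| = 1 :> C.
Proof. by rewrite normC_normc normc_cis. Qed.

Lemma Ugrp_twisted L (x : R) : (forall T, T \in L -> Ugrp R c d T) ->
  Ugrp R c d (twisted_prod L (cis x)).
Proof.
move=> hL; rewrite /twisted_prod big_seq.
apply: (big_ind (Ugrp R c d)) => [|M T|T TL]; first exact: Ugrp1.
  exact: Ugrp_mul.
by apply: Ugrp_mul; [exact/Ugrp_Uz/normC_cis|exact: hL].
Qed.

(** The same product is formed over the polynomial ring; evaluation is a ring morphism and commutes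
    with products, blocks and determinants. *)
Lemma twisted_prod_poly L : exists p : {poly C},
  forall z, p.[z] = \det (drsubmx (twisted_prod L z)).
Proof.
pose PU : 'M[{poly C}]_m := block_mx 'X%:M 0 0 1%:M.
exists (\det (drsubmx (\prod_(T <- L) (PU *m map_mx polyC T)))) => z.
have fE (p : {poly C}) : p.[z] = horner_eval z p by [].
rewrite fE -det_map_mx map_drsubmx; congr (\det (drsubmx _)).
rewrite (big_morph (map_mx (horner_eval z))
  (@map_mxM _ _ (horner_eval z) m m m) (map_mx1 _ _)).
apply: eq_bigr => T _; rewrite map_mxM; congr (_ *m _).
  by rewrite map_block_mx !map_scalar_mx !map_mx0 /= /horner_eval hornerX hornerC.
by apply/matrixP => i j; rewrite !mxE; exact: hornerC.
Qed.

Lemma det_twisted0 L :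
  \det (drsubmx (twisted_prod L 0)) = \prod_(T <- L) \det (drsubmx T).
Proof.
(* A vanishing upper right block makes the lower right block multiplicative; it also holds for the
   empty product. *)
suff [_ //] : ursubmx (twisted_prod L 0) = 0 /\
  \det (drsubmx (twisted_prod L 0)) = \prod_(T <- L) \det (drsubmx T).
rewrite /twisted_prod; elim: L => [|T L [IHu IHd]].
  rewrite !big_nil [1]scalar_mx_block block_mxKur block_mxKdr det1; by [].
rewrite !big_cons; move: (\prod_(S <- L) _) IHu IHd => M Mu <-.
rewrite -[T in Uz 0 *m T]submxK /Uz raddf0 mulmx_block !(mul0mx, mul1mx, addr0, add0r).
rewrite -![_ * M]/(_ *m M).
have -> : block_mx (0 : 'M[C]_c) 0 (dlsubmx T) (drsubmx T) *m M =
    block_mx 0 0 (dlsubmx T *m ulsubmx M + drsubmx T *m dlsubmx M)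
                 (drsubmx T *m drsubmx M).
  by rewrite -{1}[M]submxK mulmx_block Mu !(mul0mx, mulmx0, addr0, add0r).
by rewrite block_mxKur block_mxKdr det_mulmx.
Qed.

End products.

(** * Means over the phase *)

Section means.
Variables (R : realType) (c d : nat).
Local Notation C := R[i].
Local Notation m := (c + d)%N.
Local Notation mu := (@lebesgue_measure R).
Implicit Types (T : 'M[C]_m) (L : seq 'M[C]_m).

(** Stated for arbitrary lists, so that it also applies to repetitions of [L], that is, to powers of
    the product. *)
Lemma Nfun_mean L : (forall T, T \in L -> Ugrp R c d T) ->
  continuous (fun x : R => Nfun d (twisted_prod L (cis (2 * pi * x)))) /\
  (\int[mu]_(x in `[0%R, 1%R]) Nfun d (twisted_prod L (cis (2 * pi * x))) =
   \sum_(T <- L) Nfun d T)%R.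
Proof.
move=> hL; have [p pE] := twisted_prod_poly L.
have pn0 z : normc z <= 1 -> p.[z] != 0.
  move=> z1; rewrite pE; apply/contracting_det/contracting_twisted => //.
  by rewrite normC_normc lecR.
have fE : (fun x : R => Nfun d (twisted_prod L (cis (2 * pi * x)))) =
          (fun x => ln (normc p.[cis (2 * pi * x)])).
  by apply/funext => x; rewrite Nfun_Ugrp ?pE //; exact: Ugrp_twisted.
have [cf If] := Rintegral_log_poly pn0.
rewrite fE; split=> //; rewrite If pE det_twisted0.
rewrite big_seq_cond [RHS]big_seq_cond.
suff [] : 0 < normc (\prod_(T <- L | (T \in L) && true) \det (drsubmx T)) /\
  ln (normc (\prod_(T <- L | (T \in L) && true) \det (drsubmx T))) =
  \sum_(T <- L | (T \in L) && true) Nfun d T by [].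
apply: (big_rec2 (fun x y => 0 < normc x /\ ln (normc x) = y)).
  by rewrite ComplexField.Normc.normc1 ln1.
move=> T x y /andP[TL _] [x0 <-]; have hT := hL T TL.
have T0 := det_drsubmx_gt0 hT.
by rewrite ComplexField.Normc.normcM mulr_gt0 // Nfun_Ugrp // lnM.
Qed.

Lemma Nfun_ge0 (r n : nat) (A : 'M[C]_n) : 0 <= Nfun r A.
Proof.
apply: sumr_ge0 => i _; set x := nth _ _ _.
have x_ge0 : 0 <= x.
  have [lt_i|ge_i] := ltnP i (size (singular_values A)); last by rewrite /x nth_default.
  have : x \in singular_values A by exact: mem_nth.
  by rewrite mem_sort => /mapP[k _ ->]; exact: sqrtr_ge0.
(* With [0^-1 = 0] and [ln 0 = 0] the term vanishes; this also covers indices past the end, where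
   [nth] returns 0. *)
have [->|x0] := eqVneq x 0; first by rewrite invr0 addr0 mul0r ln0.
have x_gt0 : 0 < x by rewrite lt_neqAle eq_sym x0.
rewrite ln_ge0 // ler_pdivlMr ?ltr0n // mul1r -subr_ge0.
have -> : x + x^-1 - 2 = (x - 1) ^+ 2 / x by field.
by rewrite divr_ge0 // sqr_ge0.
Qed.

Lemma det_drsubmx_ge1 T : Ugrp R c d T -> 1 <= normc (\det (drsubmx T)).
Proof.
move=> hT; have := Nfun_ge0 d T; rewrite Nfun_Ugrp // -{1}ln1.
by rewrite ler_ln ?posrE ?det_drsubmx_gt0 // ltr01.
Qed.

(** Up to a factor independent of [T], the lower right minor dominates all minors of size [d]. *)
Lemma normc_minor_le T s t : Ugrp R c d T ->
  normc (ext_power d T s t) <= 2 ^+ m * normc (\det (drsubmx T)).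
Proof.
move=> hT; set w := normc _; set D := normc _.
have D0 : 0 <= D by exact: normc_ge0.
have k0 : 0 <= 2 ^+ m :> R by rewrite exprn_ge0 // ler0n.
rewrite -(ler_pXn2r (n := 2)) ?nnegrE ?normc_ge0 ?mulr_ge0 //.
have : w ^+ 2 <= 2 ^+ m * D ^+ 2.
  rewrite -prod_add1_sv2 // -lecR rmorphXn /= -normC_normc rmorph_prod.
  apply: le_trans (norm_minor_le T s t) _.
  rewrite le_eqVlt; apply/orP; left; apply/eqP; apply: eq_bigr => i _.
  by rewrite rmorphD rmorph1 /= -spectral_gramE.
(* The factor [2 ^+ m] for the squares is weakened to its square, which avoids a root. *)
move=> /le_trans; apply; rewrite exprMn ler_wpM2r ?exprn_ge0 //.
by rewrite expr2 ler_peMr // exprn_ege1 // ler1n.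
Qed.

(** The index is that of the wedge of the last [d] basis vectors. *)
Lemma ext_power_drsubmx : exists e : 'I_#|wedge_index d m|,
  forall T, ext_power d T e e = \det (drsubmx T).
Proof.
pose s0 := [tuple rshift c i | i < d].
have s0W : s0 \in wedge_index d m.
  rewrite inE; have -> : map val s0 = iota (c + 0) d.
    by rewrite iotaDl -val_enum_ord -!map_comp; apply: eq_map.
  exact: iota_ltn_sorted.
exists (enum_rank_in s0W s0) => T; rewrite mxE enum_rankK_in //.
by congr (\det _); apply/matrixP => i j; rewrite !mxE !tnth_mktuple.
Qed.

Lemma twisted_prod_nseq L z k :
  twisted_prod (flatten (nseq k.+1 L)) z =
  twisted_prod L z *m twisted_prod (flatten (nseq k L)) z.
Proof. by rewrite /twisted_prod /= big_cat. Qed.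

Lemma ln_spectral_radius_mean L : (forall T, T \in L -> Ugrp R c d T) ->
  (\int[mu]_(x in `[0%R, 1%R])
     (ln (spectral_radius (ext_power d (twisted_prod L (cis (2 * pi * x))))))%:E
   = (\sum_(T <- L) Nfun d T)%:E)%E.
Proof.
move=> hL; have [e eE] := ext_power_drsubmx.
(* There are [k.+1] copies, so the division in [f] is never by 0 and [P 0] is the product itself. *)
pose Lk k := flatten (nseq k.+1 L).
have hLk k T : T \in Lk k -> Ugrp R c d T.
  by move=> /flattenP[L' /nseqP[-> _]]; exact: hL.
pose P k x := twisted_prod (Lk k) (cis (2 * pi * x)).
have PS k x : P k.+1 x = P 0%N x *m P k x.
  by rewrite /P /Lk twisted_prod_nseq /= cats0.
have P0 x : P 0%N x = twisted_prod L (cis (2 * pi * x)) by rewrite /P /Lk /= cats0.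
have PU k x : Ugrp R c d (P k x) by apply: Ugrp_twisted; exact: hLk.
pose f k x := Nfun d (P k x) / k.+1%:R.
have fE k x : f k x = ln (normc (ext_power d (P k x) e e)) / k.+1%:R.
  by rewrite eE /f Nfun_Ugrp.
have cf k : continuous (f k).
  move=> x; apply: cvgM; last exact: cvg_cst.
  exact: (Nfun_mean (@hLk k)).1.
have If k : (\int[mu]_(x in `[0%R, 1%R]) (f k x)%:E = (\sum_(T <- L) Nfun d T)%:E)%E.
  have sumLk : \sum_(T <- Lk k) Nfun d T = k.+1%:R * \sum_(T <- L) Nfun d T.
    rewrite mulr_natl /Lk; elim: k.+1 => [|n IH]; first by rewrite big_nil mulr0n.
    by rewrite /= big_cat IH mulrS.
  have [cN IN] := Nfun_mean (@hLk k).
  rewrite integral_continuous //; congr EFin.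
  rewrite /f; under eq_Rintegral do rewrite mulrC.
  rewrite RintegralZl //; last exact: continuous_integrable_itv.
  by rewrite IN sumLk mulKf // pnatr_eq0.
pose K : R := 2 ^+ m.
have K1 : 1 <= K by rewrite exprn_ege1 // ler1n.
have domin k x i j :
    normc (ext_power d (P k x) i j) <= K * normc (ext_power d (P k x) e e).
  by rewrite eE normc_minor_le.
have ge1 k x : 1 <= normc (ext_power d (P k x) e e).
  by rewrite eE det_drsubmx_ge1.
(* By [domin], [A] makes the [e]-th diagonal entries submultiplicative in [k]. *)
pose A : R := #|wedge_index d m|%:R * K * K.
have A0 : 0 < A.
  rewrite !mulr_gt0 ?(lt_le_trans ltr01 K1) // ltr0n.
  exact: leq_ltn_trans (ltn_ord e).
(* Submultiplicativity gives, by induction, [(k+1) f_k <= (k+1) (ln A + f_0)]: a continuous bound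
   independent of [k], as dominated convergence requires. *)
have fle k x : 0 <= f k x <= ln A + f 0%N x.
  have a0 j : 0 < normc (ext_power d (P j x) e e) by exact: lt_le_trans (ge1 j x).
  have k0 : 0 < k.+1%:R :> R by rewrite ltr0n.
  rewrite {1}/f divr_ge0 ?Nfun_ge0 ?ler0n //= !fE divr1 ler_pdivrMr //.
  have lnA : 0 <= ln A.
    rewrite ln_ge0 // /A !mulr_ege1 // ler1n.
    exact: leq_ltn_trans (ltn_ord e).
  elim: k {k0} => [|k IH]; first by rewrite mulr1 lerDr.
  set u := ln A + _ in IH *.
  apply: (@le_trans _ _ (u + u * k.+1%:R)); last by rewrite -[k.+2%:R]nat1r mulrDr mulr1.
  have Aa0 := mulr_gt0 A0 (a0 0%N); have Aaa0 := mulr_gt0 Aa0 (a0 k).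
  apply: le_trans (lerD (lexx u) IH); rewrite /u -!lnM ?posrE //.
  rewrite ler_ln ?posrE // PS ext_powerM mxE.
  apply: le_trans (ler_normc_sum _) _.
  set a := normc (ext_power d (P 0%N x) e e); set b := normc (ext_power d (P k x) e e).
  have -> : A * a * b = \sum_(j < #|wedge_index d m|) (K * a) * (K * b).
    by rewrite sumr_const card_ord -mulr_natl /A; ring.
  apply: ler_sum => j _; rewrite ComplexField.Normc.normcM.
  by apply: ler_pM; rewrite ?normc_ge0 ?domin.
have cvgf x : `[0%R, 1%R] x -> (fun k => (f k x)%:E) @ \oo -->
    (ln (spectral_radius (ext_power d (twisted_prod L (cis (2 * pi * x))))))%:E.
  move=> _; apply: cvg_EFin; first exact: nearW.
  under eq_fun do rewrite /= fE.
  apply: (cvg_ln_spectral_radius (K := K) (M := fun k => ext_power d (P k x))) => //.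
  - by rewrite P0.
  - by move=> k; rewrite PS ext_powerM P0.
have cg : continuous (fun x => ln A + f 0%N x).
  by move=> x; apply: cvgD; [exact: cvg_cst|exact: cf].
have lim : (\int[mu]_(x in `[0%R, 1%R]) (f k x)%:E)%E @[k --> \oo] -->
    (\int[mu]_(x in `[0%R, 1%R])
      (ln (spectral_radius (ext_power d (twisted_prod L (cis (2 * pi * x))))))%:E)%E.
  apply: (@dominated_cvg _ _ _ mu `[0%R, 1%R] _ (fun k x => (f k x)%:E)
    _ (fun x => (ln A + f 0%N x)%:E)) => //.
  - by move=> k; apply: (measurable_int mu); exact: continuous_integrable_itv.
  - exact: continuous_integrable_itv.
  - move=> k x _; case/andP: (fle k x) => f0 fu.
    by rewrite abse_EFin lee_fin ger0_norm.
have limc : (\int[mu]_(x in `[0%R, 1%R]) (f k x)%:E)%E @[k --> \oo] -->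
    (\sum_(T <- L) Nfun d T)%:E.
  by under eq_fun do rewrite If; exact: cvg_cst.
by rewrite -(cvg_lim (@ereal_hausdorff R) lim) (cvg_lim (@ereal_hausdorff R) limc).
Qed.

End means.

Theorem theorem1p2 (R : realType) (c d n : nat)
  (hc : (1 <= c)%N) (hd : (1 <= d)%N) (hn : (1 <= n)%N)
  (T : 'I_n -> 'M[R[i]]_(c + d)) (hT : forall j, Ugrp R c d (T j)) :
  (\int[@lebesgue_measure R]_(theta in `[0%R, 1%R])
     (Nfun d (\prod_(j < n) (Umx c d theta *m T j)))%:E
   = (\sum_(j < n) Nfun d (T j))%:E)%E
  /\
  (\int[@lebesgue_measure R]_(theta in `[0%R, 1%R])
     (ln (spectral_radius (ext_power d (\prod_(j < n) (Umx c d theta *m T j)))))%:E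
   = (\sum_(j < n) Nfun d (T j))%:E)%E.
Proof.
pose L := [seq T j | j <- index_enum 'I_n].
have hL S : S \in L -> Ugrp R c d S by move=> /mapP[j _ ->].
(* [Umx c d theta] unfolds to [Uz] at [cis (2 * pi * theta)]. *)
have prodE theta : \prod_(j < n) (Umx c d theta *m T j) =
    twisted_prod L (cis (2 * pi * theta)).
  by rewrite /twisted_prod big_map.
have sumE : \sum_(j < n) Nfun d (T j) = \sum_(S <- L) Nfun d S by rewrite big_map.
rewrite sumE; split; under eq_integral do rewrite prodE; last first.
  exact: ln_spectral_radius_mean.
have [cN <-] := Nfun_mean hL.
exact: integral_continuous.
Qed.
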